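(* Let $S=Conv_{L^{0}}(\{x_{1},x_{2},\cdots,x_{n}\})$ be an $(n-1)$-dimensional $L^{0}$-simplex in a regular $L^{0}$-module $E$ and $\mathscr{S}$ be an $L^{0}$-simplicial subdivision of $S$, with associated simplicial subdivision $\mathscr{S}'$ of $S'$. Then: (1) For any proper $L^{0}$-labeling function $\phi$ of $\mathscr{S}$, $\mathcal{N}_{\phi(y)}\subseteq\chi(y)$ for every $y\in ext(\mathscr{S}')$. (2) For any proper $L^{0}$-labeling function $\phi$ of $\mathscr{S}$ and any $y\in ext(\mathscr{S}')$, there exists a family $\{\psi_{i}:i\in\mathcal{N}_{\phi(y)}\}$ of proper labeling functions of $\mathscr{S}'$ with $\psi_{i}(y)=i$ for each $i\in\mathcal{N}_{\phi(y)}$, namely $$\phi(y)=\sum_{i\in\mathcal{N}_{\phi(y)}}I_{(\phi(y)=i)}\psi_{i}(y).$$ (3) Denote $ext(\mathscr{S}')=\{y_{k}:k=1,\dots,K\}$ and let $\phi$ be a proper $L^{0}$-labeling function of $\mathscr{S}$. Then there exist a finite family $\{\psi_{m}:m=1,\dots,M\}$ of proper labeling functions of $\mathscr{S}'$ and $\{a_{m}:m=1,\dots,M\}\in p(1)$ such that $$\phi(y_{k})=\sum_{m=1}^{M}I_{a_{m}}\psi_{m}(y_{k})\quad\text{for any }k\in\{1,2,\cdots,K\}.$$ More generally, $$\phi(y)=\sum_{k=1}^{K}I_{b_{k}}\sum_{m=1}^{M}I_{a_{m}}\psi_{m}(y_{k})$$ for any $y=\sum_{k=1}^{K}I_{b_{k}}y_{k}\in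 ext_{L^{0}}(\mathscr{S})$ with $\{b_{k}:k=1,\dots,K\}\in p(1)$.
   Context: Let $(\Omega,\mathcal{F},P)$ be a probability space and $\mathbb{K}=\mathbb{R}$ or $\mathbb{C}$. $L^0(\mathcal{F},\mathbb{K})$ is the algebra of a.s.-equivalence classes of $\mathbb{K}$-valued random variables; $L^0(\mathcal{F})=L^0(\mathcal{F},\mathbb{R})$ has the a.s. order, $L^0_+(\mathcal{F})=\{\xi\in L^0(\mathcal{F}):\xi\ge0\}$. For a separable metric space $M$ (e.g. $\{1,\dots,n\}$ or $(0,1)$), $L^0(\mathcal{F},M)$ is the set of equivalence classes of $M$-valued measurable functions. $B_{\mathcal{F}}$ is the measure algebra ($\mathcal{F}$ modulo null sets), a complete Boolean algebra with $1=[\Omega]$, $0=[\emptyset]$; for $a=[A]\in B_{\mathcal{F}}$, $I_a$ is the class of the indicator of $A$. $(\xi=\eta)\in B_{\mathcal{F}}$ is the class of the event where representatives of $\xi,\eta$ agree. $p(1)$ is the collection of partitions of unity of $B_{\mathcal{F}}$ (families of pairwise disjoint elements, possibly $0$, with supremum $1$). For $\xi\in L^0(\mathcal{F},\{1,\dots,n\})$, $\mathcal{N}_\xi=\{i:(\xi=i)>0\}$. An $L^0$-module is a left module $E$ over $L^0(\mathcal{F},\mathbb{K})$ (also a linear space over $\mathbb{K}$); it is regular if $x=y$ whenever $I_{a_n}x=I_{a_n}y$ for all $n$ for some $\{a_n,n\in\mathbb{N}\}\in p(1)$. A nonempty $G\subseteq E$ is $\sigma$-stable if for each sequence $\{x_n\}$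 in $G$ and $\{a_n\}\in p(1)$ there is $x\in G$ with $I_{a_n}x=I_{a_n}x_n$ for all $n$; this unique $x$ is written $\sum_n I_{a_n}x_n$. If $G$ is $\sigma$-stable and $\emptyset\ne H\subseteq G$, $\sigma(H)=\{\sum_n I_{a_n}h_n: h_n\in H,\{a_n\}\in p(1)\}$. A mapping $f$ between $\sigma$-stable sets is $\sigma$-stable if $f(\sum_n I_{a_n}x_n)=\sum_n I_{a_n}f(x_n)$ always. $Conv_{L^0}(G)=\{\sum_{i=1}^k\xi_i x_i:k\in\mathbb{N},x_i\in G,\xi_i\in L^0_+(\mathcal{F}),\sum_i\xi_i=1\}$. $\{x_1,\dots,x_n\}\subseteq E$ is $L^0$-affinely independent if $n=1$, or $n>1$ and $\{x_i-x_1:2\le i\le n\}$ is $L^0$-linearly independent ($\sum\xi_i(x_i-x_1)=0$ with $\xi_i\in L^0(\mathcal{F},\mathbb{K})$ implies all $\xi_i=0$). Then $S=Conv_{L^0}(\{x_1,\dots,x_n\})$ is an $(n-1)$-dimensional $L^0$-simplex with vertices $x_1,\dots,x_n$ (an $L^0$-simplex is always considered together with its given vertices); its $L^0$-faces are the sets $Conv_{L^0}(\{x_i:i\in I\})$, $\emptyset\neq I\subseteq\{1,\dots,n\}$. Such $S$ is $\sigma$-stable and each $x\in S$ is uniquely $\sum_i\xi_ix_i$ with $\xi_i\in L^0_+(\mathcal{F})$, $\sum_i\xi_i=1$. Its associated simplex is the classical simplex $S'=Conv(\{x_1,\dots,x_n\})$ (usual convex hull). A simplicial subdivision of a classical $(n-1)$-dimensional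 simplex $S'$ is a finite family $\mathscr{S}'$ of $(n-1)$-dimensional simplexes with $S'=\bigcup\mathscr{S}'$ such that any two members have intersection empty or a common face of both. A finite family $\mathscr{S}$ of $(n-1)$-dimensional $L^0$-simplexes is an $L^0$-simplicial subdivision of $S$ if (1) $S=\sigma(\bigcup\mathscr{S})$; (2) for $S_1,S_2\in\mathscr{S}$, $S_1\cap S_2$ is empty or a common $L^0$-face of $S_1$ and $S_2$; (3) $\mathscr{S}'=\{G':G\in\mathscr{S}\}$ is a simplicial subdivision of $S'$ (the associated simplicial subdivision). $ext(G)$ is the set of usual extreme points of a subset $G$ of a linear space, and $ext(\mathscr{S}')=\bigcup_{G\in\mathscr{S}'}ext(G)$. A point $h\in G$ is an $L^0$-extreme point of $G$ if $x,y\in G$ and $\lambda x+(1-\lambda)y=h$ for some $\lambda\in L^0(\mathcal{F},(0,1))$ imply $x=y=h$; $ext_{L^0}(G)$ is the set of these, and $ext_{L^0}(\mathscr{S})=\sigma[\bigcup_{G\in\mathscr{S}}ext_{L^0}(G)]$. For $y=\sum_{i=1}^n\alpha_ix_i\in S'$ (real $\alpha_i\ge0$, $\sum_i\alpha_i=1$), $\chi(y)=\{i:\alpha_i>0\}$. A proper labeling function of $\mathscr{S}'$ is a mapping $\psi:ext(\mathscr{S}')\to\{1,\dots,n\}$ with $\psi(y)\in\chi(y)$ for all $y\in ext(\mathscr{S}')$. An $L^0$-labeling function of $\mathscr{S}$ is a $\sigma$-stable mapping $\phi:ext_{L^0}(\mathscr{S})\to L^0(\mathcal{F},\{1,\dots,n\})$.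 It is proper if $(\phi(y)=i)\wedge(\lambda_i=0)=0$ for all $y=\sum_{i=1}^n\lambda_ix_i\in ext_{L^0}(\mathscr{S})$ (with $\lambda_i\in L^0_+(\mathcal{F})$, $\sum_i\lambda_i=1$) and all $i$. *)

(* Defs.v *)
From HB Require Import structures.
From mathcomp Require Import all_boot all_order all_algebra complex.
From mathcomp Require Import all_classical all_reals all_analysis.

Set Implicit Arguments.
Unset Strict Implicit.
Unset Printing Implicit Defensive.
Import Order.TTheory GRing.Theory Num.Theory.
Import numFieldNormedType.Exports.
Local Open Scope classical_set_scope.
Local Open Scope ring_scope.

Inductive scalar_kind := RealScalars | ComplexScalars.

(* In R[i] the order of mathcomp is partial: 0 <= z means that z is a
   nonnegative real. *)
Definition scalar (R : realType) (k : scalar_kind) : numFieldType :=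
  match k with RealScalars => R | ComplexScalars => R[i] end.

Definition borel (T : ptopologicalType) := g_sigma_algebraType (@open T).
HB.instance Definition _ (T : ptopologicalType) :=
  Measurable.on (borel T).

HB.instance Definition _ n := isPointed.Build 'I_n.+1 ord0.
HB.instance Definition _ n := @isMeasurable.Build default_measure_display
  'I_n.+1 discrete_measurable discrete_measurable0
  discrete_measurableC discrete_measurableU.

Section second_countable_scalar.

Let archi_dense_second_countable (K : numFieldType) (D : set K) :
  (forall e : K, 0 < e -> exists m : nat, m.+1%:R^-1 < e) ->
  countable D -> dense D -> @second_countable K.
Proof.
move=> archi cD dD.
pose f (p : K * nat) : set K := ball p.1 p.2.+1%:R^-1.
exists (f @` (D `*` setT)); first exact/(sub_countable (card_image_le _ _))/countableX.
split=> [_ [p _ <-]|x V /nbhs_ballP[e /= e0 xeV]].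
  by apply: ball_open; rewrite invr_gt0.
have [m me] := archi _ (divr_gt0 e0 (ltr0n _ 2)).
have m0 : 0 < m.+1%:R^-1 :> K by rewrite invr_gt0.
have [y [xy Dy]] : ball x m.+1%:R^-1 `&` D !=set0.
  apply: dD; last exact: ball_open.
  by exists x; exact: ballxx.
exists (f (y, m)); first by split; [exists (y, m)|exact: ball_sym].
move=> z yz; apply: xeV; rewrite [e]splitr.
apply: (@ball_triangle _ _ y).
  exact: le_ball (ltW me) _ xy.
exact: le_ball (ltW me) _ yz.
Qed.

Lemma second_countable_scalar (R : realType) k : @second_countable (scalar R k).
Proof.
have archi (e : R) : 0 < e -> exists m : nat, m.+1%:R^-1 < e.
  move=> e0; have [//|m] := @ltr_add_invr R 0 e.
  by rewrite add0r => me; exists m.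
case: k => /=.
  apply: (@archi_dense_second_countable R (@ratr R @` setT)) => //.
  - exact: sub_countable (card_image_le _ _) _.
  - exact: dense_rat.
pose g (q : rat * rat) : R[i] := (ratr q.1 +i* ratr q.2)%C.
apply: (@archi_dense_second_countable R[i] (g @` setT)).
- move=> [a b]; rewrite ltcE /= => /andP[/eqP -> /archi[m ma]].
  exists m; rewrite -[m.+1%:R](rmorph_nat (real_complex R)) -fmorphV /=.
  by rewrite ltcE /= eqxx.
- exact: sub_countable (card_image_le _ _) _.
move=> A [[a b] Ar]; rewrite openE => /(_ _ Ar)/nbhs_ballP[[e e']/=].
rewrite ltcE /= => /andP[/eqP -> {e'} e0] reA.
have e20 : 0 < e / 2 by rewrite divr_gt0.
have [p /itvP pa] := rat_in_itvoo (ltr_pwDr e20 (lexx a)).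
have [q /itvP qb] := rat_in_itvoo (ltr_pwDr e20 (lexx b)).
exists (g (p, q)); split; last by exists (p, q).
apply: reA; rewrite /ball /= -normrN opprB.
rewrite [X in `|X|](_ : _ =
  (ratr p - a)%:C%C + 'i%C * (ratr q - b)%:C%C :> R[i]); last first.
  by apply/eqP; rewrite eq_complex /=; apply/andP; split; apply/eqP;
    rewrite /=; rewrite ?(mul0r, mul1r, mulr0, add0r, addr0, subr0, subrr).
apply: le_lt_trans (ler_normD _ _) _.
rewrite normrM (_ : `|'i%C| = 1 :> R[i]) ?mul1r; last first.
  by rewrite normc_def /= expr0n expr1n add0r sqrtr1.
rewrite !normc_def /= !expr0n !addr0 !sqrtr_sqr -rmorphD /= ltcE /= eqxx /=.
rewrite [e]splitr ltrD// ger0_norm ?subr_ge0 ?ltrBlDl ?pa ?qb//;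
  by rewrite ltW// ?pa ?qb.
Qed.

End second_countable_scalar.

Section borel_measurability.
Context d (Omega : measurableType d) (K L : ptopologicalType).

Lemma measurable_fun_continuous2 (op : K * K -> L) (f g : Omega -> borel K) :
  @second_countable K -> continuous op ->
  measurable_fun setT f -> measurable_fun setT g ->
  measurable_fun setT ((fun w => op (f w, g w)) : Omega -> borel L).
Proof.
move=> [B cB [oB bB]] cop mf mg.
apply: (@measurability _ _ Omega (borel L) setT _ (@open L) (erefl _)) => _ [U oU <-].
rewrite setTI.
have oopU : open (op @^-1` U) by move/continuousP: cop; apply.
pose D := [set p : set K * set K | [/\ B p.1, B p.2 & p.1 `*` p.2 `<=` op @^-1` U]].
have -> : (fun w => op (f w, g w)) @^-1` U =
    \bigcup_(p in D) (f @^-1` p.1 `&` g @^-1` p.2).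
  apply/seteqP; split=> [w Uw|w [[A1 A2] [_ _ /= sub] [A1w A2w]]]; last first.
    exact: (sub (f w, g w)).
  have [[V1 V2] /= [V1f V2g] V12] : nbhs (f w, g w) (op @^-1` U).
    exact: open_nbhs_nbhs.
  have [A1 [BA1 A1f] A1V] := bB _ _ V1f.
  have [A2 [BA2 A2g] A2V] := bB _ _ V2g.
  exists (A1, A2) => //; split => //= -[u v] [/= A1u A2v].
  by apply: V12; split; [exact: A1V|exact: A2V].
have cD : countable D.
  apply: sub_countable (countableX cB cB); apply: subset_card_le.
  by move=> p [].
rewrite bigcup_set_type; apply: countable_bigcupT_measurable.
  by rewrite (eq_countable (card_setT _)).
move=> [p /set_mem[Bp1 Bp2 _]] /=.
by apply: measurableI; rewrite -[X in measurable X]setTI;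
  [apply: mf|apply: mg] => //; apply: sub_sigma_algebra; exact: oB.
Qed.

Lemma measurable_fun_continuous1 (op : K -> L) (f : Omega -> borel K) :
  continuous op -> measurable_fun setT f ->
  measurable_fun setT ((fun w => op (f w)) : Omega -> borel L).
Proof.
move=> cop mf; apply: (@measurability _ _ Omega (borel L) setT _ (@open L) (erefl _)) => _ [U oU <-].
rewrite setTI -[X in measurable X]setTI; apply: (mf measurableT (op @^-1` U)).
by apply: sub_sigma_algebra; move/continuousP: cop; apply.
Qed.

End borel_measurability.

Section L0.
Context d (Omega : measurableType d) (R : realType) (P : probability Omega R).

Definition L0 d' (M : measurableType d') : Type := {mfun_ P, Omega >-> M}.
HB.instance Definition _ d' (M : measurableType d') := Choice.on (L0 M).

Definition L0_to_fun d' (M : measurableType d') (u : L0 M) : Omega -> M :=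
  aqEqMfun_to_fun u.
Coercion L0_to_fun : L0 >-> Funclass.

Definition L0class d' (M : measurableType d') (f : Omega -> M)
    (mf : measurable_fun setT f) : L0 M :=
  \pi_(L0 M)%qT (mfun_Sub (mem_set mf)).

Lemma L0classE d' (M : measurableType d') (f : Omega -> M)
    (mf : measurable_fun setT f) : L0class mf = f %[ae P].
Proof.
rewrite /L0class; set g := mfun_Sub _.
have /eqmodP/asboolP := reprK (\pi_(L0 M)%qT g).
by [].
Qed.

Lemma L0P d' (M : measurableType d') (u v : L0 M) : u = v %[ae P] -> u = v.
Proof.
move=> uv; rewrite -[u]reprK -[v]reprK; apply/eqP; rewrite eqmodE.
exact/asboolP.
Qed.

Lemma measurable_L0 d' (M : measurableType d') (u : L0 M) :
  measurable_fun setT u.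
Proof. exact: measurable_funPT. Qed.

Definition L0map d1 d2 (M : measurableType d1) (N : measurableType d2)
    (f : M -> N) (mf : measurable_fun setT f) (u : L0 M) : L0 N :=
  L0class (measurableT_comp mf (measurable_L0 u)).

Definition L0cst d' (M : measurableType d') (m : M) : L0 M :=
  L0class (@measurable_cst _ _ Omega M setT m).

Lemma L0mapE d1 d2 (M : measurableType d1) (N : measurableType d2)
    (f : M -> N) (mf : measurable_fun setT f) (u : L0 M) :
  L0map mf u = f \o u %[ae P].
Proof. exact: L0classE. Qed.

Lemma L0cstE d' (M : measurableType d') (m : M) : L0cst m = cst m %[ae P].
Proof. exact: L0classE. Qed.

End L0.

Arguments L0 {d Omega R} P {d'} M.
Arguments L0cst {d Omega R} P {d' M} m.

Notation L0K P k := (L0 P (borel (scalar _ k))).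

Section L0_ring.
Context d (Omega : measurableType d) (R : realType) (P : probability Omega R).
Variable k : scalar_kind.
Local Notation K := (scalar R k).
Local Notation L0 := (L0 P (borel K)).
Implicit Types u v : L0.

Definition L0add u v : L0 := L0class P (measurable_fun_continuous2
  (second_countable_scalar R k) (@add_continuous K)
  (measurable_L0 u) (measurable_L0 v)).

Definition L0mul u v : L0 := L0class P (measurable_fun_continuous2
  (second_countable_scalar R k) (@mul_continuous K)
  (measurable_L0 u) (measurable_L0 v)).

Definition L0opp u : L0 := L0class P (measurable_fun_continuous1
  (@opp_continuous K) (measurable_L0 u)).

Lemma L0addE u v : L0add u v = (fun w => (u w : K) + v w) %[ae P].
Proof. exact: L0classE. Qed.

Lemma L0mulE u v : L0mul u v = (fun w => (u w : K) * v w) %[ae P].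
Proof. exact: L0classE. Qed.

Lemma L0oppE u : L0opp u = (fun w => - (u w : K)) %[ae P].
Proof. exact: L0classE. Qed.

Let L0addA : associative L0add.
Proof.
move=> u v t; apply: L0P.
apply: filter_app (L0addE u v).
apply: filter_app (L0addE (L0add u v) t).
apply: filter_app (L0addE v t).
apply: filter_app (L0addE u (L0add v t)).
apply: aeW => w h1 h2 h3 h4 _.
by rewrite h1// h2// h3// h4// addrA.
Qed.

Let L0addC : commutative L0add.
Proof.
move=> u v; apply: L0P.
apply: filter_app (L0addE v u).
apply: filter_app (L0addE u v).
apply: aeW => w h1 h2 _.
by rewrite h1// h2// addrC.
Qed.

Let L0add0 : left_id (L0cst P (0 : borel K)) L0add.
Proof.
move=> u; apply: L0P.
apply: filter_app (L0cstE P (0 : borel K)).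
apply: filter_app (L0addE (L0cst P (0 : borel K)) u).
apply: aeW => w h1 h2 _.
by rewrite h1// h2// add0r.
Qed.

Let L0addN : left_inverse (L0cst P (0 : borel K)) L0opp L0add.
Proof.
move=> u; apply: L0P.
apply: filter_app (L0cstE P (0 : borel K)).
apply: filter_app (L0oppE u).
apply: filter_app (L0addE (L0opp u) u).
apply: aeW => w h1 h2 h3 _.
by rewrite h1// h2// h3// addNr.
Qed.

HB.instance Definition _ := GRing.isZmodule.Build L0 L0addA L0addC L0add0 L0addN.

Let L0mulA : associative L0mul.
Proof.
move=> u v t; apply: L0P.
apply: filter_app (L0mulE u v).
apply: filter_app (L0mulE (L0mul u v) t).
apply: filter_app (L0mulE v t).
apply: filter_app (L0mulE u (L0mul v t)).
apply: aeW => w h1 h2 h3 h4 _.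
by rewrite h1// h2// h3// h4// mulrA.
Qed.

Let L0mulC : commutative L0mul.
Proof.
move=> u v; apply: L0P.
apply: filter_app (L0mulE v u).
apply: filter_app (L0mulE u v).
apply: aeW => w h1 h2 _.
by rewrite h1// h2// mulrC.
Qed.

Let L0mul1 : left_id (L0cst P (1 : borel K)) L0mul.
Proof.
move=> u; apply: L0P.
apply: filter_app (L0cstE P (1 : borel K)).
apply: filter_app (L0mulE (L0cst P (1 : borel K)) u).
apply: aeW => w h1 h2 _.
by rewrite h1// h2// mul1r.
Qed.

Let L0mulD : left_distributive L0mul L0add.
Proof.
move=> u v t; apply: L0P.
apply: filter_app (L0addE (L0mul u t) (L0mul v t)).
apply: filter_app (L0mulE v t).
apply: filter_app (L0mulE u t).
apply: filter_app (L0addE u v).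
apply: filter_app (L0mulE (L0add u v) t).
apply: aeW => w h1 h2 h3 h4 h5 _.
by rewrite h1// h2// h5// h3// h4// mulrDl.
Qed.

Let L0one_neq0 : L0cst P (1 : borel K) != 0.
Proof.
apply/eqP => e10.
have h : \forall w \ae P, (1 : K) = 0.
  apply: filter_app (L0cstE P (0 : borel K)).
  apply: filter_app (L0cstE P (1 : borel K)).
  by apply: aeW => w h1 h0; rewrite -[LHS](h1 I) e10; exact: h0.
have PF : ProperFilter (almost_everywhere P).
  apply: ae_properfilter_algebraOfSetsType.
  by rewrite [X in (_ < X)%E](@probability_setT _ _ _ P) lte01.
by have [_ /eqP] := @filter_ex _ _ PF _ h; rewrite oner_eq0.
Qed.

HB.instance Definition _ := GRing.Zmodule_isComNzRing.Build L0
  L0mulA L0mulC L0mul1 L0mulD L0one_neq0.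

End L0_ring.

(* The class of an event is encoded as the class of its bool-valued
   indicator. *)
Notation measure_algebra P := (L0 P bool).

Section measure_algebra.
Context d (Omega : measurableType d) (R : realType) (P : probability Omega R).
Local Notation B := (measure_algebra P).
Implicit Types a b : B.

Lemma measurable_event (A : set Omega) :
  measurable A -> measurable_fun setT (fun w => `[< A w >]).
Proof.
move=> mA; apply: (measurable_fun_bool true).
by rewrite setTI (_ : _ @^-1` _ = A)//; apply/seteqP; split => w /asboolP.
Qed.

(* Only meaningful for measurable A. *)
Definition event_class (A : set Omega) : B :=
  if pselect (measurable A) is left mA then L0class P (measurable_event mA)
  else L0cst P false.

Definition event0 : B := event_class set0.
Definition event1 : B := event_class setT.
Definition event_meet a b : B :=
  event_class [set w | a w && b w].
Definition event_le a b := event_meet a b = a.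

Definition event_eq d' (M : measurableType d') (u v : L0 P M) :
  B := event_class [set w | u w = v w].

Definition partition_of_unity (T : Type) (a : T -> B) :=
  (forall s t, s <> t -> event_meet (a s) (a t) = event0) /\
  (forall b, (forall t, event_le (a t) b) -> b = event1).

Lemma measurable_indicator k :
  measurable_fun setT (fun b : bool => b%:R : borel (scalar R k)).
Proof. by []. Qed.

Definition indicator k a : L0K P k := L0map (@measurable_indicator k) a.

Definition value_set n (u : L0 P 'I_n.+1) : set 'I_n.+1 :=
  [set i | event_eq u (L0cst P i) != event0].

Lemma measurable_label_value k n :
  measurable_fun setT (fun i : 'I_n.+1 => i.+1%:R : borel (scalar R k)).
Proof. by []. Qed.

(* Labels are numbered from 0: i : 'I_n.+1 stands for the label i + 1. This is
   the inclusion of L^0(F, {1, ..., n + 1}) in L^0(F, K). *)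
Definition label_value k n (u : L0 P 'I_n.+1) : L0K P k :=
  L0map (@measurable_label_value k n) u.

End measure_algebra.

Arguments indicator {d Omega R P} k a.
Arguments label_value {d Omega R P} k {n} u.

Section L0_modules.
Context d (Omega : measurableType d) (R : realType) (P : probability Omega R).
Variable k : scalar_kind.
Local Notation K := (scalar R k).
Local Notation L := (L0K P k).

Definition scalar_cst (c : K) : L := L0cst P (c : borel K).

(* L^0_+(F), as a subset of L^0(F, K). *)
Definition L0_nonneg (u : L) := \forall w \ae P, 0 <= (u w : K).

(* L^0(F, (0, 1)), as a subset of L^0(F, K). *)
Definition L0_itv01 (u : L) := \forall w \ae P, 0 < (u w : K) < 1.

Section sigma.
Variable E : lmodType L.

Definition regular_module := forall a : nat -> measure_algebra P,
  partition_of_unity a -> forall x y : E,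
  (forall m, indicator k (a m) *: x = indicator k (a m) *: y) -> x = y.

(* x = \sum_t I_(a t) (x_ t) *)
Definition glues (T : Type) (a : T -> measure_algebra P) (x_ : T -> E)
  (x : E) := forall t, indicator k (a t) *: x = indicator k (a t) *: x_ t.

Definition sigma_hull (H : set E) : set E :=
  [set x | exists (a : nat -> measure_algebra P) (h : nat -> E),
    [/\ partition_of_unity a, forall m, H (h m) & glues a h x]].

End sigma.

Definition sigma_stable_map (E F : lmodType L) (G : set E) (f : E -> F) :=
  forall (a : nat -> measure_algebra P) (x_ : nat -> E) (x : E),
  partition_of_unity a -> (forall m, G (x_ m)) -> G x -> glues a x_ x ->
  glues a (f \o x_) (f x).

Variable E : lmodType L.

Definition convL0 (G : set E) : set E :=
  [set x | exists m (xi : 'I_m -> L) (g : 'I_m -> E),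
    [/\ forall i, G (g i), forall i, L0_nonneg (xi i), \sum_i xi i = 1
      & x = \sum_i xi i *: g i]].

Definition conv (G : set E) : set E :=
  [set x | exists m (alpha : 'I_m -> K) (g : 'I_m -> E),
    [/\ forall i, G (g i), forall i, 0 <= alpha i, \sum_i alpha i = 1
      & x = \sum_i scalar_cst (alpha i) *: g i]].

Definition extL0 (G : set E) : set E :=
  [set h | G h /\ forall x y lambda, G x -> G y -> L0_itv01 lambda ->
    lambda *: x + (1 - lambda) *: y = h -> x = h /\ y = h].

Definition ext (G : set E) : set E :=
  [set h | G h /\ forall x y (lambda : K), G x -> G y -> 0 < lambda < 1 ->
    scalar_cst lambda *: x + scalar_cst (1 - lambda) *: y = h -> x = h /\ y = h].

(* A simplex is given by its family of vertices v : 'I_n.+1 -> E, so that n is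
   its dimension. *)
Section simplexes.
Variable n : nat.
Implicit Types v x : 'I_n.+1 -> E.

Definition L0_affinely_independent v := forall xi : 'I_n -> L,
  \sum_i xi i *: (v (lift ord0 i) - v ord0) = 0 -> forall i, xi i = 0.

Definition affinely_independent v := forall alpha : 'I_n -> K,
  (forall i, alpha i \is Num.real) ->
  \sum_i scalar_cst (alpha i) *: (v (lift ord0 i) - v ord0) = 0 ->
  forall i, alpha i = 0.

Definition L0_simplex v : set E := convL0 (range v).
Definition simplex v : set E := conv (range v).

Definition L0_face v (F : set E) :=
  exists2 I : set 'I_n.+1, I !=set0 & F = convL0 (v @` I).
Definition face v (F : set E) :=
  exists2 I : set 'I_n.+1, I !=set0 & F = conv (v @` I).

Definition simplicial_subdivision x N (V : 'I_N -> 'I_n.+1 -> E) :=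
  [/\ forall j, affinely_independent (V j),
      simplex x = \bigcup_j simplex (V j)
    & forall i j, let C := simplex (V i) `&` simplex (V j) in
        C = set0 \/ face (V i) C /\ face (V j) C].

Definition L0_simplicial_subdivision x N (V : 'I_N -> 'I_n.+1 -> E) :=
  [/\ forall j, L0_affinely_independent (V j),
      L0_simplex x = sigma_hull (\bigcup_j L0_simplex (V j)),
      forall i j, let C := L0_simplex (V i) `&` L0_simplex (V j) in
        C = set0 \/ L0_face (V i) C /\ L0_face (V j) C
    & simplicial_subdivision x V].

Definition ext_subdivision N (V : 'I_N -> 'I_n.+1 -> E) : set E :=
  \bigcup_j ext (simplex (V j)).

Definition extL0_subdivision N (V : 'I_N -> 'I_n.+1 -> E) : set E :=
  sigma_hull (\bigcup_j extL0 (L0_simplex (V j))).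

(* The coefficients alpha are unique when x is affinely independent. *)
Definition carrier x (y : E) : set 'I_n.+1 :=
  [set i | exists alpha : 'I_n.+1 -> K,
    [/\ forall j, 0 <= alpha j, \sum_j alpha j = 1,
        y = \sum_j scalar_cst (alpha j) *: x j & 0 < alpha i]].

(* Labeling functions are total on E; only their values on the vertices of the
   subdivision are constrained. *)
Definition proper_labeling x N (V : 'I_N -> 'I_n.+1 -> E)
    (psi : E -> 'I_n.+1) :=
  forall y, ext_subdivision V y -> carrier x y (psi y).

Definition L0_labeling N (V : 'I_N -> 'I_n.+1 -> E)
    (phi : E -> L0 P 'I_n.+1) :=
  @sigma_stable_map E L^o (extL0_subdivision V) (label_value k \o phi).

Definition proper_L0_labeling x N (V : 'I_N -> 'I_n.+1 -> E)
    (phi : E -> L0 P 'I_n.+1) :=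
  L0_labeling V phi /\
  forall (y : E) (lambda : 'I_n.+1 -> L), extL0_subdivision V y ->
    (forall i, L0_nonneg (lambda i)) -> \sum_i lambda i = 1 ->
    y = \sum_i lambda i *: x i ->
    forall i, event_meet (event_eq (phi y) (L0cst P i))
                         (event_eq (lambda i) 0) = event0 P.

End simplexes.
End L0_modules.

(* Main.v *)
Require Import Defs.
From mathcomp Require Import all_boot all_order all_algebra complex.
From mathcomp Require Import all_classical all_reals all_analysis.
Set Implicit Arguments.
Unset Strict Implicit.
Unset Printing Implicit Defensive.
Import Order.TTheory GRing.Theory Num.Theory.
Import numFieldNormedType.Exports.
Local Open Scope classical_set_scope.
Local Open Scope ring_scope.

(** A vertex [y] of the associated subdivision has constant barycentric
    coordinates, so properness of [phi] at [y] says that [phi y] lies a.e. in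
    the carrier of [y].  Hence the finitely many labels
    [(phi y_1 w, ..., phi y_K w)] form, for a.e. [w], a proper labeling; the
    events on which this tuple takes a given value partition [Omega], and on
    each of them [phi] agrees with one proper labeling.  The last formula then
    follows by stability of [phi] under gluing. *)

(** * Events and partitions of unity read on representatives *)

Section almost_everywhere.
Context d (Omega : measurableType d) (R : realType) (P : probability Omega R).

Lemma ae_forall (T : finType) (Q : T -> Omega -> Prop) :
  (forall t, \forall w \ae P, Q t w) -> \forall w \ae P, forall t, Q t w.
Proof. exact: filter_forall. Qed.

Lemma L0_ext d' (M : measurableType d') (u v : L0 P M) :
  (\forall w \ae P, u w = v w) -> u = v.
Proof. by move=> uv; apply: L0P; apply: filterS uv. Qed.

Lemma ae_L0cst d' (M : measurableType d') (m : M) :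
  \forall w \ae P, L0cst P m w = m.
Proof. by apply: filterS (L0cstE P m) => w; apply. Qed.

Lemma ae_event_class (A : set Omega) : measurable A ->
  \forall w \ae P, event_class P A w = `[< A w >].
Proof.
move=> mA; rewrite /event_class; case: pselect => // mA'.
by apply: filterS (L0classE P (measurable_event mA')) => w; apply.
Qed.

Lemma ae_event0 : \forall w \ae P, event0 P w = false.
Proof.
by apply: filterS (ae_event_class measurable0) => w ->; apply/asboolP.
Qed.

Lemma ae_event1 : \forall w \ae P, event1 P w.
Proof. by apply: filterS (ae_event_class measurableT) => w ->; apply/asboolP. Qed.

Lemma measurable_L0_event (a : measure_algebra P) : measurable [set w | a w].
Proof.
rewrite -[X in measurable X]setTI.
exact: (measurable_L0 a measurableT (_ : measurable [set true])).
Qed.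

Lemma ae_event_meet (a b : measure_algebra P) :
  \forall w \ae P, event_meet a b w = a w && b w.
Proof.
have : measurable [set w | a w && b w].
  rewrite (_ : [set _ | _] = [set w | a w] `&` [set w | b w]).
    by apply: measurableI; exact: measurable_L0_event.
  by apply/seteqP; split => w /= => [/andP|[-> ->]].
by move/ae_event_class; apply: filterS => w ->; apply/asboolP/idP.
Qed.

Lemma event_meet0l (a : measure_algebra P) : event_meet (event0 P) a = event0 P.
Proof.
apply: L0_ext; apply: filter_app ae_event0.
by apply: filterS (ae_event_meet (event0 P) a) => w -> ->.
Qed.

Lemma event_meet0r (a : measure_algebra P) : event_meet a (event0 P) = event0 P.
Proof.
apply: L0_ext; apply: filter_app ae_event0.
by apply: filterS (ae_event_meet a (event0 P)) => w -> ->; rewrite andbF.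
Qed.

Lemma event_meet1r (a : measure_algebra P) : event_meet a (event1 P) = a.
Proof.
apply: L0_ext; apply: filter_app ae_event1.
by apply: filterS (ae_event_meet a (event1 P)) => w -> ->; rewrite andbT.
Qed.

Lemma event_eqxx d' (M : measurableType d') (u : L0 P M) :
  event_eq u u = event1 P.
Proof. by congr event_class; apply/seteqP. Qed.

Lemma measurable_L0_fiber n (u : L0 P 'I_n.+1) i : measurable [set w | u w = i].
Proof.
rewrite -[X in measurable X]setTI.
exact: (measurable_L0 u measurableT (_ : measurable [set i])).
Qed.

Lemma ae_event_eq n (u : L0 P 'I_n.+1) i :
  \forall w \ae P, event_eq u (L0cst P i) w = (u w == i).
Proof.
(* [event_class] is only meaningful on measurable sets; agreement is measurable as a finite union
   over the common label. *)
have : measurable [set w | u w = L0cst P i w].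
  rewrite (_ : [set _ | _] =
      \big[setU/set0]_(j < n.+1)
        ([set w | u w = j] `&` [set w | L0cst P i w = j])).
    by apply: bigsetU_measurable => j _; apply: measurableI; exact: measurable_L0_fiber.
  rewrite -bigcup_mkord_ord; apply/seteqP; split => w /=.
    by move=> uw; exists (u w) => //=; rewrite inord_val.
  by move=> [j _ [-> ->]].
move/ae_event_class; apply: filter_app; apply: filterS (ae_L0cst i) => w iw.
by rewrite /event_eq => ->; apply/asboolP/eqP; rewrite /= iw.
Qed.

(** Each label outside [value_set u] is taken only on a null set, and there are finitely many
    labels. *)
Lemma ae_value_set n (u : L0 P 'I_n.+1) : \forall w \ae P, value_set u (u w).
Proof.
have h i : \forall w \ae P, u w = i -> value_set u i.
  have [e0|] := eqVneq (event_eq u (L0cst P i)) (event0 P); last first.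
    by move=> ?; apply: aeW.
  apply: filter_app ae_event0; apply: filterS (ae_event_eq u i) => w.
  by rewrite e0 => -> /eqP.
by apply: filterS (ae_forall h) => w; apply.
Qed.

(** The supremum condition becomes a pointwise covering when tested against the union of the
    members, measurable because [T] is finite. Disjointness then costs one null set per pair. *)
Lemma ae_partition (T : finType) (a : T -> measure_algebra P) :
  partition_of_unity a ->
  \forall w \ae P, exists s, forall t, a t w = (t == s).
Proof.
move=> [disj sup].
have mU : measurable [set w | exists t, a t w].
  rewrite (_ : [set _ | _] = \bigcup_(t in [set: T]) [set w | a t w]).
    by apply: fin_bigcup_measurable => // t _; exact: measurable_L0_event.
  by apply/seteqP; split => w /= [t]; exists t.
have U1 : event_class P [set w | exists t, a t w] = event1 P.
  apply: sup => t; apply: L0_ext; apply: filter_app (ae_event_class mU).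
  apply: filterS (ae_event_meet (a t) (event_class P [set w | exists t, a t w])).
  move=> w -> ->; case: (boolP (a t w)) => //= atw.
  by apply/asboolP; exists t.
have D : \forall w \ae P, forall s t, s != t -> ~~ (a s w && a t w).
  apply: ae_forall => s; apply: ae_forall => t.
  case: (eqVneq s t) => [_|/eqP/disj e]; first exact: aeW.
  apply: filter_app ae_event0.
  by apply: filterS (ae_event_meet (a s) (a t)) => w; rewrite e => <- ->.
apply: filter_app D; apply: filter_app ae_event1.
apply: filterS (ae_event_class mU) => w; rewrite U1 => -> /asboolP[s asw] D.
exists s => t; case: eqVneq => [->//|/D]; rewrite asw andbT.
exact: negbTE.
Qed.

Lemma partition_ae (T : finType) (a : T -> measure_algebra P) :
  (\forall w \ae P, exists s, forall t, a t w = (t == s)) -> partition_of_unity a.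
Proof.
move=> h; split=> [s t /eqP st|b ab].
  apply: L0_ext; apply: filter_app h; apply: filter_app ae_event0.
  apply: filterS (ae_event_meet (a s) (a t)) => w -> -> [r ar].
  by rewrite !ar; apply/negP => /andP[/eqP sr /eqP tr]; rewrite sr tr eqxx in st.
apply: L0_ext; apply: filter_app h; apply: filter_app ae_event1.
have : \forall w \ae P, forall t, a t w -> b w.
  apply: ae_forall => t; apply: filterS (ae_event_meet (a t) b) => w.
  by rewrite (ab t) => -> /andP[].
by apply: filterS => w ab' -> [s /(_ s)]; rewrite eqxx => /ab'.
Qed.

(** Stability of maps is stated for sequences, so a finite partition is padded with null events. *)
Lemma partition_nat K (a : 'I_K -> measure_algebra P) : partition_of_unity a ->
  partition_of_unity (fun m => if insub m is Some j then a j else event0 P).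
Proof.
move=> [disj sup]; split=> [s t st|b ab].
  case: insubP => [i _ si|_]; last by rewrite event_meet0l.
  case: insubP => [j _ tj|_]; last by rewrite event_meet0r.
  by apply: disj => ij; apply: st; rewrite -si -tj ij.
by apply: sup => j; have := ab j; rewrite valK.
Qed.

(** * Pointwise arithmetic in $L^0$: constants, sums and indicators *)

Section scalars.
Variable k : scalar_kind.
Local Notation K := (Defs.scalar R k).
Local Notation L := (L0K P k).

Lemma ae_add (u v : L) : \forall w \ae P, (u + v : L) w = (u w : K) + v w.
Proof. by apply: filterS (L0addE u v) => w; apply. Qed.

Lemma ae_mul (u v : L) : \forall w \ae P, (u * v : L) w = (u w : K) * v w.
Proof. by apply: filterS (L0mulE u v) => w; apply. Qed.

Lemma ae_opp (u : L) : \forall w \ae P, (- u : L) w = - (u w : K).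
Proof. by apply: filterS (L0oppE u) => w; apply. Qed.

Lemma ae_0 : \forall w \ae P, (0 : L) w = 0 :> K.
Proof. exact: (ae_L0cst (0 : borel K)). Qed.

Lemma ae_1 : \forall w \ae P, (1 : L) w = 1 :> K.
Proof. exact: (ae_L0cst (1 : borel K)). Qed.

Lemma ae_sum I (r : seq I) (Q : pred I) (F : I -> L) :
  \forall w \ae P, (\sum_(i <- r | Q i) F i : L) w = \sum_(i <- r | Q i) (F i w : K).
Proof.
elim: r => [|i r IH].
  by apply: filterS ae_0 => w w0; rewrite !big_nil.
apply: filter_app IH; apply: filterS (ae_add (F i) (\sum_(i <- r | Q i) F i)).
by move=> w + IH; rewrite !big_cons; case: ifP => // _ ->; rewrite IH.
Qed.

Lemma ae_natr m : \forall w \ae P, (m%:R : L) w = m%:R :> K.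
Proof.
elim: m => [|m IH]; first exact: ae_0.
apply: filter_app IH; apply: filter_app ae_1.
by apply: filterS (ae_add 1 m%:R) => w + h1 hm; rewrite !mulrS h1 hm.
Qed.

Lemma ae_indicator (a : measure_algebra P) :
  \forall w \ae P, indicator k a w = (a w)%:R :> K.
Proof. by apply: filterS (L0mapE (@measurable_indicator R k) a) => w /(_ I). Qed.

Lemma ae_label_value n (u : L0 P 'I_n.+1) :
  \forall w \ae P, label_value k u w = (u w).+1%:R :> K.
Proof. by apply: filterS (L0mapE (@measurable_label_value R k n) u) => w /(_ I). Qed.

Lemma scalar_cst0 : @scalar_cst _ _ _ P k 0 = 0.
Proof. by []. Qed.

Lemma scalar_cst1 : @scalar_cst _ _ _ P k 1 = 1.
Proof. by []. Qed.

Lemma scalar_cstD (a b : K) :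
  scalar_cst P (a + b) = scalar_cst P a + scalar_cst P b.
Proof.
apply: L0_ext; apply: filter_app (ae_L0cst ((a + b) : borel K)).
apply: filter_app (ae_L0cst (a : borel K)).
apply: filter_app (ae_L0cst (b : borel K)).
by apply: filterS (ae_add (scalar_cst P a) (scalar_cst P b)) => w -> -> -> ->.
Qed.

Lemma scalar_cstM (a b : K) :
  scalar_cst P (a * b) = scalar_cst P a * scalar_cst P b.
Proof.
apply: L0_ext; apply: filter_app (ae_L0cst ((a * b) : borel K)).
apply: filter_app (ae_L0cst (a : borel K)).
apply: filter_app (ae_L0cst (b : borel K)).
by apply: filterS (ae_mul (scalar_cst P a) (scalar_cst P b)) => w -> -> -> ->.
Qed.

Lemma scalar_cst_sum I (r : seq I) (Q : pred I) (F : I -> K) :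
  scalar_cst P (\sum_(i <- r | Q i) F i) = \sum_(i <- r | Q i) scalar_cst P (F i).
Proof. exact: (big_morph _ scalar_cstD scalar_cst0). Qed.

Lemma scalar_cst_nonneg (a : K) : 0 <= a -> L0_nonneg (scalar_cst P a).
Proof. by move=> a0; apply: filterS (ae_L0cst (a : borel K)) => w ->. Qed.

Lemma L0_nonneg_sum I (r : seq I) (Q : pred I) (F : I -> L) :
  (forall i, L0_nonneg (F i)) -> L0_nonneg (\sum_(i <- r | Q i) F i).
Proof.
move=> F0; apply: (@big_ind _ (@L0_nonneg _ _ _ P k)) => //.
  by apply: filterS ae_0 => w ->.
move=> u v u0 v0; apply: filter_app u0; apply: filter_app v0.
by apply: filterS (ae_add u v) => w -> v0 u0; exact: addr_ge0.
Qed.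

Lemma indicator0 : indicator k (event0 P) = 0.
Proof.
apply: L0_ext; apply: filter_app ae_0; apply: filter_app ae_event0.
by apply: filterS (ae_indicator (event0 P)) => w -> -> ->.
Qed.

Lemma indicatorM (a b : measure_algebra P) :
  indicator k a * indicator k b = indicator k (event_meet a b).
Proof.
apply: L0_ext; apply: filter_app (ae_mul (indicator k a) (indicator k b)).
apply: filter_app (ae_indicator a); apply: filter_app (ae_indicator b).
apply: filter_app (ae_event_meet a b).
by apply: filterS (ae_indicator (event_meet a b)) => w -> -> -> -> ->; rewrite -natrM mulnb.
Qed.

Lemma sum_indicator K' (a : 'I_K' -> measure_algebra P) :
  partition_of_unity a -> \sum_j indicator k (a j) = 1.
Proof.
move=> /ae_partition h; apply: L0_ext; apply: filter_app h.
apply: filter_app ae_1.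
apply: filter_app (ae_forall (fun j => ae_indicator (a j))).
apply: filterS (ae_sum (index_enum _) xpredT (fun j => indicator k (a j))).
move=> w -> ia -> [s as_].
under eq_bigr do rewrite ia as_.
by rewrite (bigD1 s) //= eqxx big1 ?addr0 // => i /negbTE ->.
Qed.

End scalars.
End almost_everywhere.

(** A [numDomainType] covers the complex scalars too, whose order is partial. *)
Lemma pos_comb_eq0 (F : numDomainType) (a b s t : F) :
  0 < a -> 0 < b -> 0 <= s -> 0 <= t -> a * s + b * t = 0 -> s = 0 /\ t = 0.
Proof.
move=> a0 b0 s0 t0 /eqP.
rewrite paddr_eq0; [|by rewrite mulr_ge0 // ltW|by rewrite mulr_ge0 // ltW].
by rewrite !mulf_eq0 (gt_eqF a0) (gt_eqF b0) => /andP[/eqP -> /eqP ->].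
Qed.

(** * Barycentric coordinates and extreme points of simplexes *)

Section simplexes.
Context d (Omega : measurableType d) (R : realType) (P : probability Omega R).
Variables (k : scalar_kind) (E : lmodType (L0K P k)) (n : nat).
Local Notation K := (Defs.scalar R k).
Local Notation L := (L0K P k).
Implicit Types v x : 'I_n.+1 -> E.

(** Convex combinations over [range v] may repeat vertices; collecting the coefficients of each
    vertex turns them into barycentric form. *)
Lemma sum_reindex_vertices m (c : 'I_m -> L) (h : 'I_m -> 'I_n.+1) v :
  \sum_i c i *: v (h i) = \sum_j (\sum_(i | h i == j) c i) *: v j.
Proof.
rewrite (partition_big h xpredT) //=; apply: eq_bigr => j _.
by rewrite scaler_suml; apply: eq_bigr => i /eqP ->.
Qed.

Lemma simplexP v y : simplex v y -> exists alpha : 'I_n.+1 -> K,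
  [/\ forall j, 0 <= alpha j, \sum_j alpha j = 1
    & y = \sum_j scalar_cst P (alpha j) *: v j].
Proof.
move=> [m [alpha [g [gv alpha0 alpha1 ->]]]].
have /boolp.choice[h hg] i : exists j, v j = g i by have [j _] := gv i; exists j.
exists (fun j => \sum_(i | h i == j) alpha i); split=> [j||].
- exact: sumr_ge0.
- by rewrite -alpha1 [in RHS](partition_big h xpredT).
- under eq_bigr do rewrite -hg.
  rewrite (sum_reindex_vertices (fun i => scalar_cst P (alpha i))).
  by apply: eq_bigr => j _; rewrite scalar_cst_sum.
Qed.

Lemma L0_simplexP v y : L0_simplex v y -> exists xi : 'I_n.+1 -> L,
  [/\ forall j, L0_nonneg (xi j), \sum_j xi j = 1 & y = \sum_j xi j *: v j].
Proof.
move=> [m [xi [g [gv xi0 xi1 ->]]]].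
have /boolp.choice[h hg] i : exists j, v j = g i by have [j _] := gv i; exists j.
exists (fun j => \sum_(i | h i == j) xi i); split=> [j||].
- exact: L0_nonneg_sum.
- by rewrite -xi1 [in RHS](partition_big h xpredT).
- under eq_bigr do rewrite -hg.
  exact: sum_reindex_vertices.
Qed.

Lemma vertex_simplex v i : simplex v (v i).
Proof.
exists 1%N, (fun=> 1), (fun=> v i).
split=> //; rewrite ?big_ord1 ?scalar_cst1 ?scale1r //.
Qed.

Lemma vertex_L0_simplex v i : L0_simplex v (v i).
Proof.
exists 1%N, (fun=> 1), (fun=> v i); split; rewrite ?big_ord1 ?scale1r //.
by move=> _; apply: filterS (@ae_1 _ _ _ P k) => w ->; exact: ler01.
Qed.

(** Pick a vertex of nonzero weight in [y]. Unless its weight is 1, [y] lies strictly between that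
    vertex and a point [z] carrying the remaining weights, and extremality identifies [y] with the
    vertex. *)
Lemma ext_simplex_vertex v y : ext (simplex v) y -> exists i, y = v i.
Proof.
move=> [/simplexP[alpha [alpha0 alpha1 yE]] yext].
have [i ai0] : exists i, alpha i != 0.
  apply/not_existsP => h; move: alpha1; rewrite big1 => [/esym/eqP|i _].
    by rewrite oner_eq0.
  by apply/eqP/negPn/negP; exact: h.
exists i; move: (alpha1); rewrite (bigD1 i) //= => ai1.
have restE : \sum_(j | j != i) alpha j = 1 - alpha i by rewrite -ai1 [RHS]addrC addKr.
have rest0 : 0 <= 1 - alpha i by rewrite -restE; exact: sumr_ge0.
have [a1|a1] := eqVneq (1 - alpha i) 0.
  have /psumr_eq0P z : \sum_(j | j != i) alpha j = 0 by rewrite restE.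
  rewrite yE (bigD1 i) //= big1 ?addr0 => [|j ji].
    by move/eqP: a1; rewrite subr_eq0 => /eqP <-; rewrite scalar_cst1 scale1r.
  by rewrite z // scalar_cst0 scale0r.
(* The remaining weights add up to [1 - alpha i], hence this normalization. *)
pose z := \sum_(j | j != i) scalar_cst P (alpha j / (1 - alpha i)) *: v j.
have zS : simplex v z.
  exists n.+1, (fun j => if j == i then 0 else alpha j / (1 - alpha i)), v.
  split=> [j|j||]; first by exists j.
  - by case: eqP => // _; exact: divr_ge0.
  - rewrite (bigD1 i) //= eqxx add0r.
    rewrite (eq_bigr (fun j => alpha j / (1 - alpha i))) => [|j /negbTE -> //].
    by rewrite -mulr_suml restE divff.
  - rewrite [RHS](bigD1 i) //= eqxx scalar_cst0 scale0r add0r.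
    by apply: eq_bigr => j /negbTE ->.
have yz : scalar_cst P (alpha i) *: v i + scalar_cst P (1 - alpha i) *: z = y.
  rewrite yE [RHS](bigD1 i) //=; congr (_ + _).
  rewrite scaler_sumr; apply: eq_bigr => j ji.
  by rewrite scalerA -scalar_cstM mulrC divfK.
(* Under a possibly partial order, [alpha i < 1] comes from [1 - alpha i] being nonnegative and
   nonzero. *)
have ai01 : 0 < alpha i < 1 by rewrite -(subr_gt0 (alpha i) 1) !lt0r ai0 alpha0 a1.
by have [<-] := yext _ _ _ (vertex_simplex v i) zS ai01 yz.
Qed.

(** The differences [c] sum to 0, so their combination of the vertices may be based at [v ord0].
    Independence kills every difference but the one at [ord0], which the zero sum kills in turn. *)
Lemma L0_affine_coordinates_inj v (xi eta : 'I_n.+1 -> L) :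
  L0_affinely_independent v -> \sum_i xi i = \sum_i eta i ->
  \sum_i xi i *: v i = \sum_i eta i *: v i -> xi =1 eta.
Proof.
move=> vfree s1 sv; pose c i := xi i - eta i.
have c0 : \sum_i c i = 0 by rewrite sumrB s1 subrr.
have cv : \sum_i c i *: (v i - v ord0) = 0.
  under eq_bigr do rewrite scalerBr.
  rewrite sumrB -scaler_suml c0 scale0r subr0.
  by under eq_bigr do rewrite scalerBl; rewrite sumrB sv subrr.
move: cv; rewrite big_ord_recl subrr scaler0 add0r => /vfree cl.
move: c0; rewrite big_ord_recl big1 // addr0 => c00 i.
apply/eqP; rewrite -subr_eq0; apply/eqP.
by case: (unliftP ord0 i) => [j|] ->; [exact: cl|exact: c00].
Qed.

(* In the coordinate of any other vertex, a strict convex combination of two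
   nonnegative functions vanishes a.e. only if both do. *)
Lemma vertex_extL0 v i : L0_affinely_independent v ->
  extL0 (L0_simplex v) (v i).
Proof.
move=> vfree; split=> [|y z lambda]; first exact: vertex_L0_simplex.
move=> /L0_simplexP[xi [xi0 xi1 ->]] /L0_simplexP[eta [eta0 eta1 ->]] l01 yz.
(* Uniqueness of coordinates splits the identity between points into one identity in [L] per
   vertex. *)
have coord j : lambda * xi j + (1 - lambda) * eta j = (j == i)%:R.
  pose c j := lambda * xi j + (1 - lambda) * eta j.
  apply: (@L0_affine_coordinates_inj v c (fun j => (j == i)%:R)) => //.
    rewrite big_split /= -!mulr_sumr xi1 eta1 !mulr1 addrC subrK.
    by rewrite (bigD1 i) //= eqxx big1 ?addr0 // => l /negbTE ->.
  have -> : \sum_j (j == i)%:R *: v j = v i.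
    rewrite (bigD1 i) //= eqxx scale1r big1 ?addr0 // => l /negbTE ->.
    by rewrite scale0r.
  rewrite -yz !scaler_sumr -big_split /=; apply: eq_bigr => l _.
  by rewrite /c scalerDl !scalerA.
have van j : j != i -> xi j = 0 /\ eta j = 0.
  move=> ji.
  have : \forall w \ae P, xi j w = 0 :> K /\ eta j w = 0 :> K.
    apply: filter_app (xi0 j); apply: filter_app (eta0 j); apply: filter_app l01.
    apply: filter_app (ae_add (lambda * xi j) ((1 - lambda) * eta j)).
    apply: filter_app (ae_mul lambda (xi j)).
    apply: filter_app (ae_mul (1 - lambda) (eta j)).
    apply: filter_app (ae_add 1 (- lambda)); apply: filter_app (ae_opp lambda).
    apply: filter_app (@ae_1 _ _ _ P k).
    apply: filterS (@ae_0 _ _ _ P k) => w.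
    rewrite coord (negbTE ji) mulr0n.
    move=> -> -> -> -> -> -> /esym h /andP[l0 l1] e0 x0.
    by apply: pos_comb_eq0 h => //; rewrite subr_gt0.
  by move=> h; split; apply: L0_ext; apply: filter_app h;
    apply: filterS (@ae_0 _ _ _ P k) => w -> [].
(* Once the other coordinates vanish, the total 1 puts all weight on [v i]; this serves both
   endpoints. *)
suff one c : (forall j, j != i -> c j = 0) -> \sum_j c j = 1 :> L ->
    \sum_j c j *: v j = v i.
  by split; apply: one => // j /van[].
move=> c0; rewrite (bigD1 i) //= big1 // addr0 => ci.
by rewrite (bigD1 i) //= ci scale1r big1 ?addr0 // => j /c0 ->; rewrite scale0r.
Qed.

Lemma sub_sigma_hull (H : set E) : H `<=` sigma_hull H.
Proof.
(* The trivial partition: everything at index 0, null events afterwards. *)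
move=> y Hy; exists (fun m => if m == 0%N then event1 P else event0 P), (fun=> y).
split=> //; split=> [s t st|b ab].
  case: eqP => [s0|_]; last by rewrite event_meet0l.
  by case: eqP => [t0|_]; [case: st; rewrite s0|rewrite event_meet0r].
have := ab 0%N; rewrite /event_le eqxx => b1.
apply: L0_ext; apply: filter_app (@ae_event1 _ _ _ P).
apply: filterS (ae_event_meet (event1 P) b) => w.
by rewrite b1 => + w1; rewrite w1 => /esym/andP[].
Qed.

Lemma carrier_nonempty x y : simplex x y -> carrier x y !=set0.
Proof.
move=> /simplexP[alpha [alpha0 alpha1 yE]].
have [i ai0] : exists i, alpha i != 0.
  apply/not_existsP => h; move: alpha1; rewrite big1 => [/esym/eqP|i _].
    by rewrite oner_eq0.
  by apply/eqP/negPn/negP; exact: h.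
by exists i, alpha; split=> //; rewrite lt0r ai0 alpha0.
Qed.

(** * Vertices of a subdivision and proper labelings of them *)

Section subdivision.
Variables (x : 'I_n.+1 -> E) (N : nat) (V : 'I_N -> 'I_n.+1 -> E).
Hypothesis xV : L0_simplicial_subdivision x V.

Lemma finite_ext_subdivision : finite_set (ext_subdivision V).
Proof.
apply: (@sub_finite_set _ _ (range (fun p : 'I_N * 'I_n.+1 => V p.1 p.2))).
  by move=> y [j _ /ext_simplex_vertex[i ->]]; exists (j, i).
exact/finite_image/finite_finset.
Qed.

(** The two notions of extreme point meet at the vertices: a classical extreme point is a vertex,
    and a vertex is $L^0$-extreme by affine independence. *)
Lemma ext_subdivision_extL0 y : ext_subdivision V y -> extL0_subdivision V y.
Proof.
move=> [j _ /ext_simplex_vertex[i ->]]; apply: sub_sigma_hull; exists j => //.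
by case: xV => + _ _ _ => /(_ j); exact: vertex_extL0.
Qed.

Lemma ext_subdivision_simplex y : ext_subdivision V y -> simplex x y.
Proof. by case: xV => _ _ _ [_ -> _] [j _ [? _]]; exists j. Qed.

(* The coordinates of a vertex of the subdivision are constant functions, so an
   event [lambda_i = 0] is either trivial or everything. *)
Lemma value_set_carrier phi y : proper_L0_labeling x V phi ->
  ext_subdivision V y -> value_set (phi y) `<=` carrier x y.
Proof.
move=> [_ phiP] Vy i; rewrite /value_set /= => phi_i.
have [alpha [alpha0 alpha1 yE]] := simplexP (ext_subdivision_simplex Vy).
exists alpha; split=> //; rewrite lt0r alpha0 andbT.
apply: contra phi_i => /eqP ai0.
have := phiP y (fun j => scalar_cst P (alpha j)) (ext_subdivision_extL0 Vy).
rewrite -scalar_cst_sum alpha1.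
move=> /(_ (fun j => scalar_cst_nonneg P (alpha0 j)) erefl yE i).
by rewrite ai0 scalar_cst0 event_eqxx event_meet1r => ->.
Qed.

(** Carriers of vertices are nonempty, so an arbitrary choice in each is a proper labeling. It
    serves below as the fallback. *)
Lemma proper_labeling_xget : proper_labeling x V (fun y => xget ord0 (carrier x y)).
Proof.
move=> y Vy; case: (carrier_nonempty (ext_subdivision_simplex Vy)) => i.
exact: xgetI.
Qed.

(** Properness is a condition at each point separately, so the fallback labeling can be altered at
    [y] alone. *)
Lemma proper_labeling_with_value y i : carrier x y i ->
  exists2 psi, proper_labeling x V psi & psi y = i.
Proof.
move=> yi; exists (fun z => if z == y then i else xget ord0 (carrier x z)).
  by move=> z Vz; case: eqP => [->//|_]; exact: proper_labeling_xget.
by rewrite eqxx.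
Qed.

(** Here [f i] stands for $\psi_i(y)$. At almost every [w] only the term of index [u w] survives. *)
Lemma label_value_sum_values (u : L0 P 'I_n.+1) (f : 'I_n.+1 -> 'I_n.+1) :
  (forall i, value_set u i -> f i = i) ->
  label_value k u = \sum_(i < n.+1 | i \in value_set u)
    indicator k (event_eq u (L0cst P i)) * (f i).+1%:R.
Proof.
move=> fK; apply: L0_ext; apply: filter_app (ae_value_set u).
apply: filter_app (ae_label_value k u).
apply: filter_app (ae_forall (fun i : 'I_n.+1 => ae_event_eq u i)).
apply: filter_app (ae_forall (fun i : 'I_n.+1 => ae_natr P k (f i).+1)).
apply: filter_app
  (ae_forall (fun i : 'I_n.+1 => ae_indicator k (event_eq u (L0cst P i)))).
apply: filter_app (ae_forall (fun i : 'I_n.+1 =>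
  ae_mul (indicator k (event_eq u (L0cst P i))) (f i).+1%:R)).
apply: filterS (ae_sum (index_enum _) (mem (value_set u)) (fun i =>
  indicator k (event_eq u (L0cst P i)) * (f i).+1%:R)).
move=> w -> wM wI wN wE -> wV.
rewrite (bigD1 (u w)) ?inE //= big1 ?addr0 => [|i /andP[_ iu]].
  by rewrite wM wI wN wE eqxx mul1r fK.
by rewrite wM wI wE eq_sym (negbTE iu) mul0r.
Qed.

Lemma label_valueMglue phi (K' : nat) (y_ : 'I_K' -> E)
    (b : 'I_K' -> measure_algebra P) (y : E) :
  L0_labeling V phi -> (forall j, extL0_subdivision V (y_ j)) ->
  partition_of_unity b -> y = \sum_j indicator k (b j) *: y_ j ->
  extL0_subdivision V y ->
  label_value k (phi y) = \sum_j indicator k (b j) * label_value k (phi (y_ j)).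
Proof.
move=> phiS Vy_ bP yE Vy.
(* Disjointness removes all terms but the [j]-th, and indicators are idempotent. *)
have glue j : indicator k (b j) *: y = indicator k (b j) *: y_ j.
  rewrite yE scaler_sumr (bigD1 j) //= big1 ?addr0 => [|i ij].
    rewrite scalerA indicatorM; congr (indicator _ _ *: _).
    apply: L0_ext; apply: filterS (ae_event_meet (b j) (b j)) => w ->.
    by rewrite andbb.
  rewrite scalerA indicatorM bP.1 ?indicator0 ?scale0r // => ji.
  by rewrite ji eqxx in ij.
have gluephi j : indicator k (b j) * label_value k (phi y) =
    indicator k (b j) * label_value k (phi (y_ j)).
  (* Past the last index the events are null, but the sequence must stay in the domain of stability;
     [y] itself is a safe filler. *)
  have := phiS _ (fun m => if insub m is Some i then y_ i else y) y
    (partition_nat bP).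
  move=> h; have := h _ Vy _ (val j); rewrite /= valK; apply.
    by move=> m; case: insubP.
  by move=> m; case: insubP => // _; rewrite indicator0 !scale0r.
rewrite -[LHS]mul1r -(sum_indicator k bP) mulr_suml.
by apply: eq_bigr => j _; exact: gluephi.
Qed.

(** * Decomposing [phi] along the joint values of its labels *)

Section joint_labels.
Variables (K' : nat) (y_ : 'I_K' -> E) (phi : E -> L0 P 'I_n.+1).
Hypothesis y_V : ext_subdivision V = range y_.
Hypothesis phiP : proper_L0_labeling x V phi.

(** As [f] varies, these are the cells, possibly null, of the common refinement of the partitions
    induced by the labels at the [y_ j]. *)
Definition joint_event (f : {ffun 'I_K' -> 'I_n.+1}) : measure_algebra P :=
  event_class P [set w | forall j, phi (y_ j) w = f j].

(* The fallback value is used only when [f] prescribes an inadmissible label at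
   [y]; for a.e. [w] the labels [f] read off from [phi] at [w] are admissible.
   Nothing forces [y_] to be injective, hence the choice of an index of [y]. *)
Definition joint_labeling (f : {ffun 'I_K' -> 'I_n.+1}) (y : E) : 'I_n.+1 :=
  if [pick j | (y_ j == y) && `[< carrier x y (f j) >]] is Some j then f j
  else xget ord0 (carrier x y).

Lemma ae_joint_event f :
  \forall w \ae P, joint_event f w = (f == [ffun j => phi (y_ j) w]).
Proof.
have : measurable [set w | forall j, phi (y_ j) w = f j].
  rewrite (_ : [set _ | _] =
      \bigcap_(j in [set: 'I_K']) [set w | phi (y_ j) w = f j]).
    by apply: fin_bigcap_measurable => // j _; exact: measurable_L0_fiber.
  by apply/seteqP; split => w /= h j; [move=> _; exact: h|exact: h].
move=> mf; apply: filterS (ae_event_class P mf) => w; rewrite /joint_event => ->.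
apply/asboolP/eqP => /= [h|-> j]; last by rewrite ffunE.
by apply/ffunP => j; rewrite ffunE h.
Qed.

(** Admissibility is tested inside the [pick], so even tuples attached to null cells yield proper
    labelings. *)
Lemma joint_labeling_proper f : proper_labeling x V (joint_labeling f).
Proof.
move=> y Vy; rewrite /joint_labeling.
by case: pickP => [j /andP[_ /asboolP]//|_]; exact: proper_labeling_xget.
Qed.

(** By [value_set_carrier] the observed labels are almost everywhere admissible, so the fallback is
    not reached. If another index [i] is picked, [y_ i] and [y_ j] coincide and so do their
    labels. *)
Lemma ae_joint_labeling : \forall w \ae P, forall j,
  joint_labeling [ffun j => phi (y_ j) w] (y_ j) = phi (y_ j) w.
Proof.
apply: filterS (ae_forall (fun j => ae_value_set (phi (y_ j)))) => w wV j.
rewrite /joint_labeling; case: pickP => [i /andP[/eqP yij _]|/(_ j)].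
  by rewrite ffunE yij.
rewrite eqxx ffunE /= => /asboolP[]; apply: value_set_carrier (wV j) => //.
by rewrite y_V; exists j.
Qed.

Lemma label_value_joint j : label_value k (phi (y_ j)) =
  \sum_(m < #|{ffun 'I_K' -> 'I_n.+1}|) indicator k (joint_event (enum_val m)) *
    (joint_labeling (enum_val m) (y_ j)).+1%:R.
Proof.
(* Summing over tuples instead of their ranks isolates the tuple observed at [w], the only one whose
   cell contains [w]. *)
rewrite (reindex enum_rank) /=; last exact/onW_bij/enum_rank_bij.
under eq_bigr do rewrite enum_rankK.
apply: L0_ext; apply: filter_app ae_joint_labeling.
apply: filter_app (ae_label_value k (phi (y_ j))).
apply: filter_app (ae_forall ae_joint_event).
apply: filter_app (ae_forall (fun f : {ffun 'I_K' -> 'I_n.+1} =>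
  ae_indicator k (joint_event f))).
apply: filter_app (ae_forall (fun f : {ffun 'I_K' -> 'I_n.+1} =>
  ae_natr P k (joint_labeling f (y_ j)).+1)).
apply: filter_app (ae_forall (fun f : {ffun 'I_K' -> 'I_n.+1} =>
  ae_mul (indicator k (joint_event f)) (joint_labeling f (y_ j)).+1%:R)).
apply: filterS (ae_sum (index_enum _) xpredT (fun f =>
  indicator k (joint_event f) * (joint_labeling f (y_ j)).+1%:R)).
move=> w -> wM wN wI wE -> wL.
rewrite (bigD1 [ffun j => phi (y_ j) w]) //= big1 ?addr0 => [|f fw].
  by rewrite wM wI wN wE eqxx mul1r wL.
by rewrite wM wI wE (negbTE fw) mul0r.
Qed.

Lemma joint_event_partition : partition_of_unity
  (fun m : 'I_#|{ffun 'I_K' -> 'I_n.+1}| => joint_event (enum_val m)).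
Proof.
apply: partition_ae; apply: filterS (ae_forall ae_joint_event) => w wE.
exists (enum_rank [ffun j => phi (y_ j) w]) => m.
by rewrite wE -(can_eq enum_valK) enum_rankK.
Qed.

End joint_labels.
End subdivision.
End simplexes.

Theorem theorem3p5 (d : measure_display) (Omega : measurableType d)
  (R : realType) (P : probability Omega R) (k : scalar_kind)
  (E : lmodType (L0K P k)) (n : nat) (x : 'I_n.+1 -> E)
  (N : nat) (V : 'I_N -> 'I_n.+1 -> E) :
  regular_module E -> L0_affinely_independent x -> L0_simplicial_subdivision x V ->
  [/\ forall phi, proper_L0_labeling x V phi ->
        forall y, ext_subdivision V y -> value_set (phi y) `<=` carrier x y,
      forall phi, proper_L0_labeling x V phi ->
        forall y, ext_subdivision V y ->
        exists psi : 'I_n.+1 -> E -> 'I_n.+1,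
          (forall i, value_set (phi y) i ->
             proper_labeling x V (psi i) /\ psi i y = i) /\
          label_value k (phi y) =
            \sum_(i < n.+1 | i \in value_set (phi y))
              indicator k (event_eq (phi y) (L0cst P i)) * (psi i y).+1%:R
    & finite_set (ext_subdivision V) /\
      forall (K : nat) (y_ : 'I_K -> E), ext_subdivision V = range y_ ->
      forall phi, proper_L0_labeling x V phi ->
      exists (M : nat) (psi : 'I_M -> E -> 'I_n.+1)
             (a : 'I_M -> measure_algebra P),
        [/\ forall m, proper_labeling x V (psi m),
            partition_of_unity a,
            forall j : 'I_K, label_value k (phi (y_ j)) =
              \sum_(m < M) indicator k (a m) * (psi m (y_ j)).+1%:R
          & forall (b : 'I_K -> measure_algebra P) (y : E),
              partition_of_unity b ->
              y = \sum_(j < K) indicator k (b j) *: y_ j ->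
              extL0_subdivision V y ->
              label_value k (phi y) = \sum_(j < K) indicator k (b j) *
                \sum_(m < M) indicator k (a m) * (psi m (y_ j)).+1%:R]].
Proof.
move=> _ _ xV; split=> [phi phiP y|phi phiP y Vy|].
- exact: value_set_carrier.
- have /boolp.choice[psi psiP] i : exists psi, value_set (phi y) i ->
      proper_labeling x V psi /\ psi y = i.
    (* Nothing is asked of labels outside the value set, so a constant map will do there. *)
    have [yi|nyi] := pselect (value_set (phi y) i); last by exists (fun=> ord0).
    have [psi ? ?] := proper_labeling_with_value xV
      (value_set_carrier xV phiP Vy yi).
    by exists psi.
  exists psi; split=> //.
  by apply: (label_value_sum_values k (f := fun i => psi i y)) => i /psiP[].
split; first exact: finite_ext_subdivision.
move=> K y_ y_V phi phiP.
(* One index per tuple of labels at the [y_ j]; [enum_val] recovers the tuple. *)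
exists #|{ffun 'I_K -> 'I_n.+1}|, (fun m => joint_labeling x y_ (enum_val m)),
  (fun m => joint_event y_ phi (enum_val m)).
have labelE := label_value_joint xV y_V phiP.
split=> [m|||b y bP yE Vy]; first exact: joint_labeling_proper.
- exact: joint_event_partition.
- exact: labelE.
(* Folding the inner sums back into the labels at the [y_ j] leaves exactly the stability of [phi]
   under finite gluing. *)
under eq_bigr do rewrite -labelE.
apply: (label_valueMglue phiP.1 _ bP yE Vy) => j.
by apply: (ext_subdivision_extL0 xV); rewrite y_V; exists j.
Qed.
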